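(* Let $r\in(0,1/2)$ and consider the independent-coding distributed delay diversity scheme described in the context, with fixed deterministic delays and relative delay $T_0=|\tau_2-\tau_1|$. Let $P(\mathrm{SNR})=\Pr[I_{TDA}<R,\ |\mathcal D(s)|=2]$. (a) If $T_0B_w>2$ and $T_0B_w$ is not an integer, then there exist constants $c_1,c_2>0$ and $\mathrm{SNR}_0$ such that for all $\mathrm{SNR}\ge\mathrm{SNR}_0$, $$c_1\,\widetilde{\mathrm{SNR}}^{-(3-4r)}\le P(\mathrm{SNR})\le c_2\,\widetilde{\mathrm{SNR}}^{-(3-6r)}.$$ (b) If $T_0B_w$ is a positive integer, then there exist constants $c_1,c_2>0$ and $\mathrm{SNR}_0$ such that for all $\mathrm{SNR}\ge\mathrm{SNR}_0$, $$c_1\,\widetilde{\mathrm{SNR}}^{-(3-4r)}\le P(\mathrm{SNR})\le c_2\,\widetilde{\mathrm{SNR}}^{-(3-4r)}.$$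
   Context: Network: a source $N_S$, two relays $N_{R_1},N_{R_2}$ and a destination $N_D$. The gains $\alpha_{i,j}$, $i\in\{S,R_1,R_2\}$, $j\in\{R_1,R_2,D\}$, $i\neq j$, are mutually independent zero-mean circularly symmetric complex Gaussian random variables with variances $\sigma^2_{i,j}>0$. For $\mathrm{SNR}>0$ set $\rho_0=\frac23\mathrm{SNR}$ and $\widetilde{\mathrm{SNR}}=\sigma^2_{S,D}\mathrm{SNR}$. The target rate is $R=r\log(1+\mathrm{SNR}\,\sigma^2_{S,D})$. Relay $R_k$ belongs to the decoding set $\mathcal D(s)$ iff $\frac12\log(1+\rho_0|\alpha_{S,R_k}|^2)\ge R$. Independent-coding distributed delay diversity scheme: - Signals have baseband bandwidth $B_w>0$. - In phase 2 all successful relays send the same Gaussian codeword, independent of the source codeword. - The signal from relay $R_k$ reaches $N_D$ with deterministic delay $\tau_k\ge0$. - Conditioned on $\mathcal D(s)$, the mutual information is $$I_{TDA}=\frac12\log(1+\rho_0|\alpha_{S,D}|^2)+\frac{1}{2B_w}\int_{-B_w/2}^{B_w/2}\log\left(1+\rho_0\Big|\sum_{R_k\in\mathcal D(s)}\alpha_{R_k,D}e^{j2\pi f\tau_k}\Big|^2\right)df,$$ where an empty sum equals $0$. *)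

(* Defs.v *)
From HB Require Import structures.
From mathcomp Require Import all_boot all_order all_algebra.
From mathcomp Require Import all_classical all_reals all_analysis.

Set Implicit Arguments.
Unset Strict Implicit.
Unset Printing Implicit Defensive.

Import Order.TTheory GRing.Theory Num.Theory.
Local Open Scope classical_set_scope.
Local Open Scope ring_scope.

(* The seven channel links alpha_{i,j}, i in {S,R1,R2}, j in {R1,R2,D}, i<>j *)
Inductive link := SR1 | SR2 | SD | R1R2 | R1D | R2R1 | R2D.

Definition link_code (l : link) : nat :=
  match l with SR1 => 0 | SR2 => 1 | SD => 2 | R1R2 => 3 | R1D => 4
  | R2R1 => 5 | R2D => 6 end.
Definition link_decode (n : nat) : option link :=
  match n with 0 => Some SR1 | 1 => Some SR2 | 2 => Some SD | 3 => Some R1R2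
  | 4 => Some R1D | 5 => Some R2R1 | 6 => Some R2D | _ => None end%N.
Lemma link_codeK : pcancel link_code link_decode. Proof. by case. Qed.
HB.instance Definition _ := Countable.copy link (pcan_type link_codeK).
Definition link_enum := [:: SR1; SR2; SD; R1R2; R1D; R2R1; R2D].
Lemma link_enumP : Finite.axiom link_enum. Proof. by case. Qed.
HB.instance Definition _ := fintype.isFinite.Build link link_enumP.

Section defs.
Context {R : realType}.

(* A complex number a = a1 + j a2 is represented by its real and imaginary
   parts.  rot_re/rot_im give the real/imaginary parts of a * e^{j theta}. *)
Definition rot_re (a1 a2 th : R) : R := a1 * cos th - a2 * sin th.
Definition rot_im (a1 a2 th : R) : R := a1 * sin th + a2 * cos th.

(* The gains alpha_l = Xre l + j Xim l (l : link) are mutually independent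
   zero-mean circularly symmetric complex Gaussian with variances sigma2 l,
   i.e. the 14 real variables Xre l, Xim l are mutually independent with
   Xre l, Xim l ~ N(0, sigma2 l / 2).  Mutual independence + marginals are
   stated as the product rule over all families of Borel sets. *)
Definition indep_CSCG d (T : measurableType d) (P : probability T R)
    (Xre Xim : link -> T -> R) (sigma2 : link -> R) : Prop :=
  forall A B : link -> set R,
    (forall l, measurable (A l) /\ measurable (B l)) ->
    P [set t | forall l, A l (Xre l t) /\ B l (Xim l t)] =
    (\prod_(l : link)
       (normal_prob 0 (Num.sqrt (sigma2 l / 2)) (A l) *
        normal_prob 0 (Num.sqrt (sigma2 l / 2)) (B l)))%E.

Definition rho0 (SNR : R) : R := 2 / 3 * SNR.

(* target rate R = r log(1 + SNR sigma^2_{S,D}) (natural log; the base is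
   immaterial as all rates use the same base) *)
Definition rate (sigma2SD r SNR : R) : R := r * ln (1 + SNR * sigma2SD).

Definition sqn (a1 a2 : R) : R := a1 ^+ 2 + a2 ^+ 2.

Definition decodes (SNR Rt a1 a2 : R) : bool :=
  Rt <= ln (1 + rho0 SNR * sqn a1 a2) / 2.

(* I_TDA conditioned on the decoding set D(s) = {R_k | dk = true}:
   sd = alpha_{S,D}, g1 = alpha_{R1,D}, g2 = alpha_{R2,D}; empty sum = 0. *)
Definition I_TDA (Bw tau1 tau2 SNR : R) (dec1 dec2 : bool)
    (sd1 sd2 g11 g12 g21 g22 : R) : \bar R :=
  let th1 f := 2 * pi * f * tau1 in
  let th2 f := 2 * pi * f * tau2 in
  let sre f := (if dec1 then rot_re g11 g12 (th1 f) else 0)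
             + (if dec2 then rot_re g21 g22 (th2 f) else 0) in
  let sim f := (if dec1 then rot_im g11 g12 (th1 f) else 0)
             + (if dec2 then rot_im g21 g22 (th2 f) else 0) in
  ((ln (1 + rho0 SNR * sqn sd1 sd2) / 2)%:E
   + ((2 * Bw)^-1)%:E *
     \int[lebesgue_measure]_(f in `[(- (Bw / 2))%R, (Bw / 2)%R])
        (ln (1 + rho0 SNR * sqn (sre f) (sim f)))%:E)%E.

Definition P_out d (T : measurableType d) (P : probability T R)
    (Xre Xim : link -> T -> R) (sigma2 : link -> R)
    (Bw tau1 tau2 r SNR : R) : \bar R :=
  let Rt := rate (sigma2 SD) r SNR in
  P [set t | let dec1 := decodes SNR Rt (Xre SR1 t) (Xim SR1 t) in
             let dec2 := decodes SNR Rt (Xre SR2 t) (Xim SR2 t) in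
             [/\ dec1, dec2 &
               (I_TDA Bw tau1 tau2 SNR dec1 dec2 (Xre SD t) (Xim SD t)
                  (Xre R1D t) (Xim R1D t) (Xre R2D t) (Xim R2D t)
                < Rt%:E)%E]].

Definition snrt (sigma2SD SNR : R) : R := sigma2SD * SNR.

End defs.

(* Main.v *)
Require Import Defs.
From HB Require Import structures.
From mathcomp Require Import all_boot all_order all_algebra.
From mathcomp Require Import all_classical all_reals all_analysis.
From mathcomp Require Import measurable_realfun ring lra.
Set Implicit Arguments.
Unset Strict Implicit.
Unset Printing Implicit Defensive.
Import Order.TTheory GRing.Theory Num.Theory.
Import numFieldNormedType.Exports.
Local Open Scope classical_set_scope.
Local Open Scope ring_scope.

(* Write s for |alpha_{S,D}|^2, A for |alpha_{R1,D}|^2 + |alpha_{R2,D}|^2 and S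
   for the normalised SNR.  For unequal delays the relay part of I_TDA equals
   (1/2) ln (1 + rho A) up to an additive constant that depends neither on the
   gains nor on rho: the received power A + 2 (p cos wf + q sin wf) is at most
   2 A, and around its minimiser c on a short interval it is at least a multiple
   of A (f - c)^2, so that the loss is controlled by the integrable singularity
   of ln |f - c|.  Outage is therefore, up to constants, the event
   (1 + rho s)(1 + rho A) < S^(2r).  A single box s <~ 1/S, A <~ S^(2r-1) gives
   the lower bound S^-1 S^(2(2r-1)) = S^-(3-4r); covering the event by the boxes
   s <~ 2^k/S, A <~ 2^-k S^(2r-1) gives a geometric series with the same order.
   This sharp bound holds for all delays with T0 > 0, and the weaker exponent
   3 - 6r of part (a) follows from it. *)

(** * Logarithmic integrals of trigonometric polynomials *)

(** Near 0 the cosine exceeds 1/2, so the mean value theorem gives [sin y >= y / 2] there. With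
    [y = |x| / 2] the identity [1 - cos x = 2 sin^2 y] yields the constant 1/8. *)
Lemma cos_quadratic_gap (R : realType) :
  exists2 eta : R, 0 < eta <= 1 &
    forall x : R, `|x| <= eta -> x ^+ 2 / 8 <= 1 - cos x.
Proof.
have [e /= e0 He] : \forall x \near (0 : R), 1 / 2 < cos x.
  have : cos x @[x --> (0 : R)] --> (1 : R) by rewrite -cos0; exact: continuous_cos.
  by move=> h; apply: (cvgr_gt _ h); lra.
have sin_half_lb (y : R) : 0 <= y -> y < e -> y / 2 <= sin y.
  move=> y0 ye.
  have dsin x : x \in `]0, y[ -> is_derive x 1 sin (cos x).
    by move=> _; exact: is_derive_sin.
  have [|c cy] := MVT_segment y0 dsin.
    exact/continuous_subspaceT/continuous_sin.
  rewrite sin0 !subr0 => ->.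
  have /He : ball_ [eta Num.Def.normr] 0 e c.
    move: cy; rewrite in_itv/= => /andP[c0 cy].
    by rewrite /= sub0r normrN ger0_norm//; lra.
  by move=> hc; rewrite mulrC ler_wpM2r//; lra.
exists (Num.min e 1); first by rewrite lt_min e0 ltr01 ge_min lexx orbT.
move=> x; rewrite le_min => /andP[xe _].
have -> : cos x = cos `|x|.
  by have [x0|/ltW x0] := leP 0 x; [rewrite ger0_norm|rewrite ler0_norm// cosN].
rewrite -[x ^+ 2]real_normK ?num_real//.
set y := `|x| / 2.
have xy : `|x| = y + y by rewrite /y; lra.
have y0 : 0 <= y by rewrite /y divr_ge0.
have sy : y / 2 <= sin y by apply: sin_half_lb => //; lra.
rewrite xy cosD -!expr2 cos2sin2.
have : (y / 2) ^+ 2 <= sin y ^+ 2 by rewrite ler_pXn2r ?nnegrE//; lra.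
nra.
Qed.

(** This is [ln (1 + x) <= x] at [x = 1 / sqrt z - 1]. The square root matters: for a quadratic [z]
    in [t], the product [t / sqrt z] stays bounded. *)
Lemma ln_ge_sub_invsqrt (R : realType) (z : R) :
  0 < z -> 2 * (1 - (Num.sqrt z)^-1) <= ln z.
Proof.
move=> z0; have s0 : 0 < Num.sqrt z by rewrite sqrtr_gt0.
have -> : ln z = 2 * ln (Num.sqrt z).
  by rewrite -[in LHS](sqr_sqrtr (ltW z0)) lnXn// mulr_natl.
have := @le_ln1Dx R ((Num.sqrt z)^-1 - 1).
have i0 : 0 < (Num.sqrt z)^-1 by rewrite invr_gt0.
rewrite (addrC 1) subrK lnV ?posrE// => /(_ _); lra.
Qed.

Section log_quadratic.
Context {R : realType}.
Variables (k delta : R).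
Hypotheses (k0 : 0 < k) (d0 : 0 < delta).

Let quad (t : R) := delta + k ^+ 2 * t ^+ 2.

Let quad_gt0 t : 0 < quad t.
Proof. by rewrite /quad ltr_wpDr// mulr_ge0 ?sqr_ge0. Qed.

(** The exact antiderivative of [ln (quad t)] has a further arctangent term. Without it the
    derivative is [g = ln quad - 2 delta / quad], a minorant of [ln quad], which is enough for a
    lower bound. *)
Let G (t : R) := t * ln (quad t) - 2 * t.

(** Since [sqrt (quad t) >= k t], the bound [ln z >= 2 - 2 / sqrt z] multiplied by [t] loses at most
    [2 / k], whatever [delta] is. *)
Let G_ge t : 0 <= t -> - (2 / k) <= G t.
Proof.
move=> t0; have s0 : 0 < Num.sqrt (quad t) by rewrite sqrtr_gt0.
have kt : k * t <= Num.sqrt (quad t).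
  rewrite -(@ler_pXn2r _ 2)// ?nnegrE ?sqrtr_ge0//; last by rewrite mulr_ge0// ltW.
  by rewrite sqr_sqrtr ?(ltW (quad_gt0 _))// exprMn /quad lerDr ltW.
have := ler_wpM2l t0 (ln_ge_sub_invsqrt (quad_gt0 t)).
have : t / Num.sqrt (quad t) <= 1 / k.
  by rewrite ler_pdivrMr// mul1r mulrC ler_pdivlMr// mulrC.
rewrite /G; nra.
Qed.

Let G_odd t : G (- t) = - G t.
Proof. by rewrite /G /quad sqrrN; ring. Qed.

Let g t := ln (quad t) - 2 * delta / quad t.

Let is_derive_quad (c x : R) :
  is_derive x 1 (fun y => quad (y - c)) (k ^+ 2 * (2 * (x - c))).
Proof.
apply: is_derive_eq.
rewrite /GRing.scale/=; ring.
Qed.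

Let is_derive_lnquad (c x : R) : is_derive x 1 (fun y => ln (quad (y - c)))
  ((quad (x - c))^-1 * (k ^+ 2 * (2 * (x - c)))).
Proof.
apply: (@is_derive1_comp _ (@ln R) (fun y => quad (y - c))).
  exact: is_derive1_ln.
exact: is_derive_quad.
Qed.

Let is_derive_G (c x : R) : is_derive x 1 (fun y => G (y - c)) (g (x - c)).
Proof.
have H := is_derive_lnquad c x.
apply: is_derive_eq.
rewrite /= /GRing.scale/= /g.
have := quad_gt0 (x - c); rewrite {1 2 3 5}/quad => q0.
by field; rewrite exprMn gt_eqF.
Qed.

Let continuous_lnquad (c : R) : continuous (fun x => ln (quad (x - c))).
Proof.
move=> x; apply: differentiable_continuous; apply/derivable1_diffP.
exact: (@ex_derive _ _ _ _ _ _ _ (is_derive_lnquad c x)).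
Qed.

Let continuous_quad (c : R) : continuous (fun x => quad (x - c)).
Proof.
move=> x; apply: differentiable_continuous; apply/derivable1_diffP.
exact: (@ex_derive _ _ _ _ _ _ _ (is_derive_quad c x)).
Qed.

Let continuous_g (c : R) : continuous (fun x => g (x - c)).
Proof.
move=> x; apply: cvgB; first exact: continuous_lnquad.
apply: cvgM; first exact: cvg_cst.
by apply: cvgV; [rewrite gt_eqF|exact: continuous_quad].
Qed.

Let continuous_G (c : R) : continuous (fun x => G (x - c)).
Proof.
move=> x; apply: differentiable_continuous; apply/derivable1_diffP.
exact: (@ex_derive _ _ _ _ _ _ _ (is_derive_G c x)).
Qed.

(** As [G] is odd, the integral of [g] is [G (v - c) + G (c - u)], and each term is at least
    [- 2 / k]. The bound is uniform in [delta], which later tends to 0 as the SNR grows. *)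
Lemma integral_ln_quadratic_ge (u v c : R) : u < v -> u <= c <= v ->
  ((- (4 / k))%:E <= \int[lebesgue_measure]_(x in `[u, v])
     (ln (delta + k ^+ 2 * (x - c) ^+ 2))%:E)%E.
Proof.
move=> uv /andP[uc cv].
apply: (@le_trans _ _ (\int[lebesgue_measure]_(x in `[u, v]) (g (x - c))%:E)%E).
  rewrite (@continuous_FTC2 _ (fun x => g (x - c)) (fun x => G (x - c)))//.
  - have vc : 0 <= v - c by rewrite subr_ge0.
    have cu : 0 <= c - u by rewrite subr_ge0.
    rewrite -EFinB lee_fin -(opprB c u) G_odd.
    by have := G_ge vc; have := G_ge cu; lra.
  - exact/continuous_subspaceT/continuous_g.
  - split.
    + by move=> x _; exact: (@ex_derive _ _ _ _ _ _ _ (is_derive_G c x)).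
    + exact/cvg_at_right_filter/continuous_G.
    + exact/cvg_at_left_filter/continuous_G.
  - move=> x _; rewrite derive1E.
    exact: (@derive_val _ _ _ _ _ _ _ (is_derive_G c x)).
apply: le_integral => //=.
- apply: continuous_compact_integrable; first exact: segment_compact.
  exact/continuous_subspaceT/continuous_g.
- apply: continuous_compact_integrable; first exact: segment_compact.
  exact/continuous_subspaceT/continuous_lnquad.
- move=> x _; rewrite lee_fin /g gerBl mulr_ge0//; first by rewrite mulr_ge0// ltW.
  by rewrite invr_ge0 ltW.
Qed.

End log_quadratic.

(** This is the power of two superposed complex gains [a], [b] as a function of their phase
    difference: [A = |a|^2 + |b|^2], and [p], [q] are the real and imaginary parts of [conj(a) b].
    The condition on [p], [q] used below is then the inequality of arithmetic and geometric
    means. *)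
Definition trigpol {R : realType} (A p q : R) (x : R) : R :=
  A + 2 * (p * cos x + q * sin x).

Section trigonometric_polynomial.
Context {R : realType}.
Variables (A p q : R).
Hypotheses (A0 : 0 <= A) (pqA : 4 * (p ^+ 2 + q ^+ 2) <= A ^+ 2).

Let sqr_ge_abs (X Y : R) : 0 <= Y -> X ^+ 2 <= Y ^+ 2 -> - Y <= X <= Y.
Proof.
move=> Y0 XY; rewrite -ler_norml -(ger0_norm Y0).
by rewrite -(@ler_pXn2r _ 2)// ?nnegrE// !real_normK ?num_real.
Qed.

(** By Cauchy-Schwarz, in the form of Lagrange's identity, the oscillating part is at most
    [2 sqrt (p^2 + q^2) <= A] in absolute value. *)
Lemma trigpol_bounds x : 0 <= trigpol A p q x <= 2 * A.
Proof.
have : - (A / 2) <= p * cos x + q * sin x <= A / 2.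
  apply: sqr_ge_abs; first by rewrite divr_ge0.
  have := cos2Dsin2 x; set c := cos x; set s := sin x => cs1.
  have -> : (p * c + q * s) ^+ 2
      = (p ^+ 2 + q ^+ 2) * (c ^+ 2 + s ^+ 2) - (p * s - q * c) ^+ 2 by ring.
  rewrite cs1 mulr1; have := sqr_ge0 (p * s - q * c).
  set Z := (_ - _) ^+ 2; move: pqA => pqA1.
  by have -> : (A / 2) ^+ 2 = A ^+ 2 / 4; [field|lra].
by rewrite /trigpol; lra.
Qed.

(* Two points of the curve cannot both be small unless they are close: the sum
   of the two values is at least [A (1 - cos (x - y)) / 2]. *)
Lemma trigpol_ge_of_le x y : trigpol A p q y <= trigpol A p q x ->
  A * (1 - cos (x - y)) / 4 <= trigpol A p q x.
Proof.
rewrite cosB /trigpol => xy.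
have := cos2Dsin2 x; have := cos2Dsin2 y; move: xy.
set c := cos x; set s := sin x; set c' := cos y; set s' := sin y.
move=> xy cs1' cs1; set C := c * c' + s * s'.
have C1 : -1 <= C <= 1.
  apply: sqr_ge_abs => //; rewrite expr1n.
  have -> : C ^+ 2 = (c ^+ 2 + s ^+ 2) * (c' ^+ 2 + s' ^+ 2) - (c * s' - s * c') ^+ 2.
    by rewrite /C; ring.
  by rewrite cs1 cs1'; have := sqr_ge0 (c * s' - s * c'); lra.
set X := p * (c + c') + q * (s + s').
(* Cauchy-Schwarz gives [X^2 <= A^2 (2 + 2C) / 4]; the bound linear in [C] replaces the square root,
   since the squares differ by exactly [(A (1 - C))^2 / 16]. *)
have : - (A * ((3 + C) / 4)) <= X <= A * ((3 + C) / 4).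
  apply: sqr_ge_abs; first by rewrite mulr_ge0//; lra.
  have X2 : X ^+ 2 <= (p ^+ 2 + q ^+ 2) * (2 + 2 * C).
    have -> : 2 + 2 * C = (c + c') ^+ 2 + (s + s') ^+ 2.
      rewrite [RHS](_ : _ = (c ^+ 2 + s ^+ 2) + (c' ^+ 2 + s' ^+ 2) + 2 * C); last first.
        by rewrite /C; ring.
      by rewrite cs1 cs1'; ring.
    rewrite -subr_ge0 (_ : _ - _ = (p * (s + s') - q * (c + c')) ^+ 2) ?sqr_ge0//.
    by rewrite /X; ring.
  have : (p ^+ 2 + q ^+ 2) * (2 + 2 * C) <= A ^+ 2 / 4 * (2 + 2 * C).
    have C11 : 0 <= 2 + 2 * C by move: C1; clearbody C; lra.
    by apply: ler_wpM2r => //; move: pqA; lra.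
  have : 0 <= (A * (1 - C)) ^+ 2 by exact: sqr_ge0.
  by nra.
by move: xy; rewrite /X; lra.
Qed.

Lemma continuous_trigpol (w : R) : continuous (fun x => trigpol A p q (w * x)).
Proof.
move=> x.
have cw : {for x, continuous (fun x => w * x)}.
  by apply: cvgM; [exact: cvg_cst|exact: cvg_id].
apply: cvgD; first exact: cvg_cst.
apply: cvgM; first exact: cvg_cst.
apply: cvgD; apply: cvgM; try exact: cvg_cst.
- apply: (@continuous_comp _ _ _ (fun x => w * x) (@cos R)) => //.
  exact: continuous_cos.
- apply: (@continuous_comp _ _ _ (fun x => w * x) (@sin R)) => //.
  exact: continuous_sin.
Qed.

Lemma continuous_ln_trigpol (rho w : R) : 0 <= rho ->
  continuous (fun x => ln (1 + rho * trigpol A p q (w * x))).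
Proof.
move=> rho0 x.
apply: (@continuous_comp _ _ _ (fun x => 1 + rho * trigpol A p q (w * x)) (@ln R)).
  apply: cvgD; first exact: cvg_cst.
  by apply: cvgM; [exact: cvg_cst|exact: continuous_trigpol].
apply: continuous_ln; rewrite ltr_pwDl// mulr_ge0//.
by case/andP: (trigpol_bounds (w * x)).
Qed.

Lemma ln_trigpol_ge0 (rho w x : R) : 0 <= rho ->
  0 <= ln (1 + rho * trigpol A p q (w * x)).
Proof.
move=> rho0; apply: ln_ge0; rewrite lerDl mulr_ge0//.
by case/andP: (trigpol_bounds (w * x)).
Qed.

(** Comparison with the minimiser [c] gives [1 + rho T >= L Q], where [T] is the polynomial,
    [L = 1 + rho A] and [Q] is quadratic around [c]. The factor [L] yields the main term and [ln Q]
    costs only a constant. *)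
Lemma integral_ln_trigpol_short_ge (eta rho w u v : R) :
  0 <= rho -> w != 0 -> eta <= 1 ->
  (forall x : R, `|x| <= eta -> x ^+ 2 / 8 <= 1 - cos x) ->
  u < v -> `|w| * (v - u) <= eta ->
  (((v - u) * ln (1 + rho * A) - 32 / `|w|)%:E <=
   \int[lebesgue_measure]_(x in `[u, v])
     (ln (1 + rho * trigpol A p q (w * x)))%:E)%E.
Proof.
move=> rho0 w0 eta1 cosgap uv wuv.
have aw0 : 0 < `|w| by rewrite normr_gt0.
have [c cuv minc] := EVT_min (ltW uv) (continuous_subspaceT (@continuous_trigpol w)).
set L := 1 + rho * A.
have L1 : 1 <= L by rewrite lerDl mulr_ge0.
(* Chosen so that [L * Q x = 1 / 2 + L * y / 2] with [y = (w (x - c))^2 / 32]. As [y <= 1], this is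
   at most [1 + rho A y], hence at most [1 + rho T]. *)
pose delta := (2 * L)^-1; pose k := `|w| / 8.
have d0 : 0 < delta by rewrite invr_gt0; lra.
have k0 : 0 < k by rewrite /k divr_gt0.
pose Q x := delta + k ^+ 2 * (x - c) ^+ 2.
have Q0 x : 0 < Q x by rewrite /Q ltr_wpDr// mulr_ge0 ?sqr_ge0.
have LQ x : x \in `[u, v] ->
    ln L + ln (Q x) <= ln (1 + rho * trigpol A p q (w * x)).
  move=> xuv; rewrite -lnM ?posrE//; last by lra.
  have T0 := trigpol_bounds (w * x).
  have rT0 : 0 <= rho * trigpol A p q (w * x) by rewrite mulr_ge0//; lra.
  rewrite ler_ln ?posrE; [|by rewrite mulr_gt0//; lra|by lra].
  have := trigpol_ge_of_le (minc _ xuv); rewrite -mulrBr.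
  have xcuv : `|x - c| <= v - u.
    by move: xuv cuv; rewrite !in_itv/= ler_norml; lra.
  have wxc : `|w * (x - c)| <= eta.
    by rewrite normrM; apply: le_trans wuv; rewrite ler_wpM2l.
  have := cosgap _ wxc; set cc := cos _ => gap Tge.
  set y := (w * (x - c)) ^+ 2 / 32.
  have y1 : y <= 1.
    have : (w * (x - c)) ^+ 2 <= 1.
      rewrite -[_ ^+ 2]real_normK ?num_real// -(expr1n _ 2) ler_pXn2r ?nnegrE//.
      exact: le_trans eta1.
    by rewrite /y; lra.
  have Ty : A * y <= trigpol A p q (w * x).
    apply: le_trans Tge; rewrite -mulrA ler_wpM2l//.
    by rewrite /y; lra.
  have -> : L * Q x = 1 / 2 + L * y / 2.
    rewrite /Q /delta /y /k mulrDr; congr (_ + _); first by field; rewrite gt_eqF//; lra.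
    by rewrite exprMn real_normK ?num_real//; field.
  have : rho * (A * y) <= rho * trigpol A p q (w * x) by rewrite ler_wpM2l.
  have y0 : 0 <= y by rewrite /y divr_ge0 ?sqr_ge0.
  have : 0 <= rho * (A * y) by rewrite mulr_ge0// mulr_ge0.
  by rewrite /L; nra.
have iLQ : lebesgue_measure.-integrable `[u, v] (EFin \o (fun x => ln (Q x))).
  apply: continuous_compact_integrable; first exact: segment_compact.
  apply: continuous_subspaceT => x.
  apply: (@continuous_comp _ _ _ Q (@ln R)); last exact: continuous_ln.
  apply: cvgD; first exact: cvg_cst.
  apply: cvgM; first exact: cvg_cst.
  apply: (@continuous_comp _ _ _ (fun x => x - c) (fun x => x ^+ 2)).
    by apply: cvgB; [exact: cvg_id|exact: cvg_cst].
  exact: exprn_continuous.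
have iL : lebesgue_measure.-integrable `[u, v] (EFin \o (fun _ => ln L)).
  apply: continuous_compact_integrable; first exact: segment_compact.
  by apply: continuous_subspaceT => x; exact: cvg_cst.
apply: (@le_trans _ _ (\int[lebesgue_measure]_(x in `[u, v]) (ln L + ln (Q x))%:E)%E).
  under eq_integral do rewrite EFinD.
  rewrite (@integralD_EFin _ _ _ lebesgue_measure `[u, v] _ _ _ iL iLQ)//.
  rewrite integral_cst//= lebesgue_measure_itv/= lte_fin uv -EFinB.
  rewrite (mulrC (v - u)) -EFinM [leLHS]EFinD leeD2l//.
  have -> : 32 / `|w| = 4 / k by rewrite /k; field; rewrite gt_eqF.
  apply: integral_ln_quadratic_ge => //.
apply: le_integral => //.
- exact: (integrableD _ iL iLQ).
- apply: continuous_compact_integrable; first exact: segment_compact.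
  exact/continuous_subspaceT/continuous_ln_trigpol.
- by move=> x; rewrite inE => xuv; rewrite lee_fin; exact: LQ.
Qed.

(** Adjacent short intervals are glued by induction; each has its own minimiser and pays its own
    loss [32 / |w|]. *)
Lemma integral_ln_trigpol_multiple_ge (eta rho w u h : R) (n : nat) :
  0 <= rho -> w != 0 -> eta <= 1 ->
  (forall x : R, `|x| <= eta -> x ^+ 2 / 8 <= 1 - cos x) ->
  0 < h -> `|w| * h <= eta ->
  ((n%:R * (h * ln (1 + rho * A) - 32 / `|w|))%:E <=
   \int[lebesgue_measure]_(x in `[u, (u + n%:R * h)%R])
     (ln (1 + rho * trigpol A p q (w * x)))%:E)%E.
Proof.
move=> rho0 w0 eta1 cosgap h0 wh.
pose f x := ln (1 + rho * trigpol A p q (w * x)); pose F : R -> \bar R := EFin \o f.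
have F0 x : (0 <= F x)%E by rewrite lee_fin ln_trigpol_ge0.
have mF : measurable_fun setT F.
  apply/measurable_EFinP; apply: continuous_measurable_fun.
  exact: continuous_ln_trigpol.
rewrite -/F.
elim: n => [|n IH].
  by rewrite mul0r; apply: integral_ge0 => x _; exact: F0.
set m := u + n%:R * h in IH *.
have um : u <= m by rewrite lerDl mulr_ge0// ltW.
have -> : u + n.+1%:R * h = m + h by rewrite /m -natr1; ring.
have mh : m < m + h by rewrite ltrDl.
rewrite (_ : [set` `[u, m + h]] = `[u, m] `|` `]m, m + h]); last first.
  by rewrite -itv_bndbnd_setU// bnd_simp// ltW.
rewrite ge0_integral_setU//=; last 3 first.
- exact: (measurable_funTS mF).
- by move=> x _; exact: F0.
- by apply/disj_setPS => x []/=; rewrite !in_itv/=; lra.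
rewrite (@integral_itv_obnd_cbnd _ m); last exact: (measurable_funTS mF).
rewrite -natr1 mulrDl EFinD leeD// mul1r.
have := @integral_ln_trigpol_short_ge eta rho w m (m + h).
by rewrite (_ : m + h - m = h); [exact|ring].
Qed.

End trigonometric_polynomial.

Lemma integral_ln_trigpol_ge (R : realType) (Bw w : R) : 0 < Bw -> w != 0 ->
  exists C : R, forall A p q rho : R,
    0 <= A -> 4 * (p ^+ 2 + q ^+ 2) <= A ^+ 2 -> 0 <= rho ->
    ((Bw * (ln (1 + rho * A) - C))%:E <=
     \int[lebesgue_measure]_(x in `[(- (Bw / 2))%R, (Bw / 2)%R])
       (ln (1 + rho * trigpol A p q (w * x)))%:E)%E.
Proof.
move=> B0 w0.
have [eta /andP[eta0 eta1] cosgap] := cos_quadratic_gap R.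
have aw0 : 0 < `|w| by rewrite normr_gt0.
(* Enough pieces for the phase to vary by at most [eta] on each. *)
pose n := (Num.truncn (`|w| * Bw / eta)).+1.
have n0 : 0 < n%:R :> R by rewrite ltr0n.
have nB : `|w| * (Bw / n%:R) <= eta.
  rewrite mulrA ler_pdivrMr// [leRHS]mulrC -ler_pdivrMr//.
  exact/ltW/truncnS_gt.
(* The total loss of the [n] pieces, normalised by the bandwidth; it is fixed before [A], [p], [q]
   and [rho]. *)
exists (n%:R * (32 / `|w|) / Bw) => A p q rho A0 pqA rho0.
have := @integral_ln_trigpol_multiple_ge R A p q A0 pqA eta rho w (- (Bw / 2))
  (Bw / n%:R) n rho0 w0 eta1 cosgap.
have -> : - (Bw / 2) + n%:R * (Bw / n%:R) = Bw / 2.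
  by rewrite [n%:R * _]mulrC divfK ?gt_eqF//; lra.
move=> /(_ (divr_gt0 B0 n0) nB); apply: le_trans.
rewrite lee_fin le_eqVlt; apply/orP; left; apply/eqP.
by field; rewrite ?gt_eqF.
Qed.

(** * Mutual information *)

Lemma sqn_ge0 (R : realType) (a b : R) : 0 <= sqn a b.
Proof. by rewrite addr_ge0 ?sqr_ge0. Qed.

Lemma sqn_rotD (R : realType) (a1 a2 b1 b2 x y : R) :
  sqn (rot_re a1 a2 x + rot_re b1 b2 y) (rot_im a1 a2 x + rot_im b1 b2 y) =
  trigpol (sqn a1 a2 + sqn b1 b2) (a1 * b1 + a2 * b2) (a1 * b2 - a2 * b1) (x - y).
Proof.
rewrite /trigpol cosB sinB.
have := cos2Dsin2 x; have := cos2Dsin2 y; rewrite /sqn /rot_re /rot_im.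
set c := cos x; set s := sin x; set c' := cos y; set s' := sin y => cs1' cs1.
rewrite [LHS](_ : _ = (a1 ^+ 2 + a2 ^+ 2) * (c ^+ 2 + s ^+ 2) +
  (b1 ^+ 2 + b2 ^+ 2) * (c' ^+ 2 + s' ^+ 2) +
  2 * ((a1 * b1 + a2 * b2) * (c * c' + s * s') +
       (a1 * b2 - a2 * b1) * (s * c' - c * s'))); last by ring.
by rewrite cs1 cs1' !mulr1.
Qed.

(** The left side is [4 |a|^2 |b|^2], and the difference of the two sides is [(|a|^2 - |b|^2)^2]. *)
Lemma sqn_cross_le (R : realType) (a1 a2 b1 b2 : R) :
  4 * ((a1 * b1 + a2 * b2) ^+ 2 + (a1 * b2 - a2 * b1) ^+ 2) <=
  (sqn a1 a2 + sqn b1 b2) ^+ 2.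
Proof.
rewrite -subr_ge0 (_ : _ - _ = (sqn a1 a2 - sqn b1 b2) ^+ 2) ?sqr_ge0//.
by rewrite /sqn; ring.
Qed.

Section mutual_information.
Context {R : realType}.
Variables (Bw tau1 tau2 SNR : R) (sd1 sd2 g11 g12 g21 g22 : R).
Hypotheses (Bw0 : 0 < Bw) (SNR0 : 0 <= SNR).

Let rho_ge0 : 0 <= rho0 SNR.
Proof. by rewrite /rho0 mulr_ge0// divr_ge0. Qed.

Let A := sqn g11 g12 + sqn g21 g22.
Let p := g11 * g21 + g12 * g22.
Let q := g11 * g22 - g12 * g21.

Let A0 : 0 <= A. Proof. by rewrite addr_ge0 ?sqn_ge0. Qed.

Lemma I_TDA_trigpol :
  I_TDA Bw tau1 tau2 SNR true true sd1 sd2 g11 g12 g21 g22 =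
  ((ln (1 + rho0 SNR * sqn sd1 sd2) / 2)%:E + ((2 * Bw)^-1)%:E *
    \int[lebesgue_measure]_(f in `[(- (Bw / 2))%R, (Bw / 2)%R])
      (ln (1 + rho0 SNR * trigpol A p q (2 * pi * (tau1 - tau2) * f)))%:E)%E.
Proof.
rewrite /I_TDA; congr (_ + _ * _)%E; apply: eq_integral => f _.
rewrite sqn_rotD.
by rewrite (_ : 2 * pi * f * tau1 - _ = 2 * pi * (tau1 - tau2) * f)//; ring.
Qed.

Lemma I_TDA_le :
  (I_TDA Bw tau1 tau2 SNR true true sd1 sd2 g11 g12 g21 g22 <=
   ((ln (1 + rho0 SNR * sqn sd1 sd2) + ln (1 + rho0 SNR * (2 * A))) / 2)%:E)%E.
Proof.
rewrite I_TDA_trigpol (mulrDl _ _ 2^-1) EFinD leeD2l//.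
set w := 2 * pi * (tau1 - tau2); set rho := rho0 SNR.
have pqA : 4 * (p ^+ 2 + q ^+ 2) <= A ^+ 2 by exact: sqn_cross_le.
have -> : (ln (1 + rho * (2 * A)) / 2)%:E =
    (((2 * Bw)^-1)%:E * (ln (1 + rho * (2 * A)) * Bw)%:E)%E.
  by rewrite -EFinM; congr EFin; field; rewrite gt_eqF.
rewrite lee_pmul2l//; last by rewrite lte_fin invr_gt0 mulr_gt0.
have -> : (ln (1 + rho * (2 * A)) * Bw)%:E =
    (\int[lebesgue_measure]_(f in `[(- (Bw / 2))%R, (Bw / 2)%R])
       cst (ln (1 + rho * (2 * A)))%:E f)%E.
  rewrite integral_cst//= lebesgue_measure_itv/= lte_fin ifT; last by move: Bw0; lra.
  by rewrite -EFinB -EFinM; congr (_ * _)%:E; lra.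
apply: ge0_le_integral => //.
- by move=> x _; rewrite lee_fin ln_trigpol_ge0.
- apply/measurable_EFinP; apply: measurable_funTS.
  apply: continuous_measurable_fun; exact: continuous_ln_trigpol.
- move=> x _; rewrite lee_fin.
  have /andP[T0 TA] := trigpol_bounds A0 pqA (w * x).
  rewrite ler_ln ?posrE ?ltr_pwDl ?mulr_ge0//.
  by rewrite lerD2l ler_wpM2l.
Qed.

(** The integral bound enters as a hypothesis so that one [C] serves all gains and all SNR; the loss
    in rate is then [C / 2]. *)
Lemma I_TDA_ge (C : R) :
  (forall A p q rho : R,
    0 <= A -> 4 * (p ^+ 2 + q ^+ 2) <= A ^+ 2 -> 0 <= rho ->
    ((Bw * (ln (1 + rho * A) - C))%:E <=
     \int[lebesgue_measure]_(x in `[(- (Bw / 2))%R, (Bw / 2)%R])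
       (ln (1 + rho * trigpol A p q (2 * pi * (tau1 - tau2) * x)))%:E)%E) ->
  (((ln (1 + rho0 SNR * sqn sd1 sd2) + ln (1 + rho0 SNR * A) - C) / 2)%:E <=
   I_TDA Bw tau1 tau2 SNR true true sd1 sd2 g11 g12 g21 g22)%E.
Proof.
move=> /(_ A p q (rho0 SNR) A0 (sqn_cross_le _ _ _ _) rho_ge0) intge.
rewrite I_TDA_trigpol -addrA (mulrDl _ _ 2^-1) EFinD leeD2l//.
have -> : ((ln (1 + rho0 SNR * A) - C) / 2)%:E =
    (((2 * Bw)^-1)%:E * (Bw * (ln (1 + rho0 SNR * A) - C))%:E)%E.
  by rewrite -EFinM; congr EFin; field; rewrite gt_eqF.
by rewrite lee_pmul2l// lte_fin invr_gt0 mulr_gt0.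
Qed.

End mutual_information.

(** * Gaussian boxes *)

Lemma normal_prob_itv_le (R : realType) (s u v : R) : s != 0 -> u <= v ->
  (normal_prob 0 s `[u, v] <= (normal_peak s * (v - u))%:E)%E.
Proof.
move=> s0 uv; rewrite /normal_prob.
apply: (@le_trans _ _ (\int[lebesgue_measure]_(x in `[u, v]) (normal_peak s)%:E)%E).
  apply: ge0_le_integral => //=.
  - by move=> x _; rewrite lee_fin normal_pdf_ge0.
  - apply/measurable_EFinP; apply: measurable_funTS; exact: measurable_normal_pdf.
  - by move=> x _; rewrite lee_fin normal_pdf_ub.
rewrite integral_cst//= lebesgue_measure_itv/= lte_fin.
case: ifPn => _; first by rewrite -EFinB -EFinM.
by rewrite mule0 lee_fin mulr_ge0 ?normal_peak_ge0 ?subr_ge0.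
Qed.

(** On [[-2, 2]] the centred density is at least its value at 2. This range contains every bounded
    interval of the decoding box. *)
Lemma normal_prob_itv_ge (R : realType) (s : R) : s != 0 ->
  exists2 m : R, 0 < m & forall u v : R, -2 <= u -> u <= v -> v <= 2 ->
    ((m * (v - u))%:E <= normal_prob 0 s `[u, v])%E.
Proof.
move=> s0; exists (normal_pdf 0 s 2).
  by rewrite normal_pdfE// mulr_gt0 ?expR_gt0 ?normal_peak_gt0.
move=> u v u2 uv v2; rewrite /normal_prob.
apply: (@le_trans _ _
    (\int[lebesgue_measure]_(x in `[u, v]) (normal_pdf 0 s 2)%:E)%E).
  rewrite integral_cst//= lebesgue_measure_itv/= lte_fin.
  case: ifPn => [_|]; first by rewrite -EFinB -EFinM.
  rewrite -leNgt => vu; rewrite (_ : v - u = 0) ?mulr0 ?mule0//.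
  by apply/eqP; rewrite subr_eq0; apply/eqP/le_anti; rewrite vu uv.
apply: ge0_le_integral => //=.
- by move=> x _; rewrite lee_fin normal_pdf_ge0.
- apply/measurable_EFinP; apply: measurable_funTS; exact: measurable_normal_pdf.
- move=> x; rewrite in_itv/= => /andP[ux xv]; rewrite lee_fin !normal_pdfE//.
  rewrite ler_wpM2l ?normal_peak_ge0// ler_expR !subr0 !mulNr lerN2.
  rewrite ler_wpM2r ?invr_ge0 ?mulrn_wge0 ?sqr_ge0//.
  rewrite -[x ^+ 2]real_normK ?num_real// ler_pXn2r ?nnegrE//.
  by rewrite ler_norml; apply/andP; split; lra.
Qed.

Lemma big_link (T : Type) (idx : T) (op : Monoid.com_law idx) (f : link -> T) :
  \big[op/idx]_(l : link) f l =
  op (f SR1) (op (f SR2) (op (f SD) (op (f R1R2)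
    (op (f R1D) (op (f R2R1) (f R2D)))))).
Proof.
rewrite (bigD1 SR1)//= (bigD1 SR2)//= (bigD1 SD)//= (bigD1 R1R2)//=.
rewrite (bigD1 R1D)//= (bigD1 R2R1)//= (bigD1 R2D)//=.
by rewrite big1 ?Monoid.mulm1//; case.
Qed.

Section gaussian_boxes.
Context {R : realType} {d : measure_display} {T : measurableType d}.
Variables (P : probability T R) (Xre Xim : link -> {RV P >-> R}).
Variable sigma2 : link -> R.
Hypothesis sigma2_gt0 : forall l, 0 < sigma2 l.
Hypothesis indep :
  indep_CSCG P (fun l => Xre l : T -> R) (fun l => Xim l : T -> R) sigma2.

Definition box_event (A B : link -> set R) : set T :=
  [set t | forall l, A l (Xre l t) /\ B l (Xim l t)].

Lemma measurable_box_event (A B : link -> set R) :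
  (forall l, measurable (A l) /\ measurable (B l)) -> measurable (box_event A B).
Proof.
move=> mAB.
have -> : box_event A B = \bigcap_(l in [set: link])
    (Xre l @^-1` A l `&` Xim l @^-1` B l).
  by apply/seteqP; split=> t /= H l; [move=> _|]; exact: H.
apply: fin_bigcap_measurable => // l _; have [mA mB] := mAB l.
apply: measurableI.
- by have := @measurable_funP _ _ _ _ setT (Xre l) measurableT _ mA; rewrite setTI.
- by have := @measurable_funP _ _ _ _ setT (Xim l) measurableT _ mB; rewrite setTI.
Qed.

Let s l := Num.sqrt (sigma2 l / 2).
Let s0 l : s l != 0.
Proof. by rewrite gt_eqF// sqrtr_gt0 divr_gt0. Qed.

Let N l := normal_prob 0 (s l).

Let N_ge0 l A : (0 <= N l A)%E.
Proof. by apply: integral_ge0 => x _; rewrite lee_fin normal_pdf_ge0. Qed.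

Let N_setT l : N l setT = 1%E. Proof. exact: integral_normal_pdf. Qed.

Let lee_prod_link (f g : link -> \bar R) : (forall l, (0 <= f l)%E) ->
  (forall l, (f l <= g l)%E) -> (\prod_l f l <= \prod_l g l)%E.
Proof.
move=> f0 fg.
suff [] : (0 <= \prod_l f l)%E /\ (\prod_l f l <= \prod_l g l)%E by [].
apply: (big_ind2 (fun a b : \bar R => (0 <= a)%E /\ (a <= b)%E)) => //.
move=> a b a' b' [a0 ab] [a0' ab']; split; first exact: mule_ge0.
exact: lee_pmul.
Qed.

Definition gain_box (x y : R) (l : link) : set R :=
  match l with SD => `[- x, x] | R1D | R2D => `[- y, y] | _ => setT end.

(** Meant for the real parts only: a real part in [[1, 2]] already makes the source-relay power at
    least 1, so both relays decode at high SNR. *)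
Definition decoding_gain_box (x y : R) (l : link) : set R :=
  match l with SR1 | SR2 => `[1, 2] | _ => gain_box x y l end.

Lemma measurable_gain_box x y l : measurable (gain_box x y l).
Proof. by case: l => /=. Qed.

Lemma measurable_decoding_gain_box x y l : measurable (decoding_gain_box x y l).
Proof. by case: l => /=. Qed.

(** By independence the probability factors: two real coordinates have width [2 x] and four have
    width [2 y], each with bounded density. *)
Lemma prob_gain_box_le : exists2 M : R, 0 < M & forall x y : R, 0 <= x -> 0 <= y ->
  (P (box_event (gain_box x y) (gain_box x y)) <= (M * (x ^+ 2 * y ^+ 4))%:E)%E.
Proof.
pose k l := 2 * normal_peak (s l).
have k0 l : 0 < k l by rewrite mulr_gt0// normal_peak_gt0.
exists (k SD ^+ 2 * (k R1D ^+ 2 * k R2D ^+ 2)).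
  by do ?[exact: k0 | apply: exprn_gt0 | apply: mulr_gt0].
move=> x y x0 y0; rewrite /box_event indep; last first.
  by move=> l; split; exact: measurable_gain_box.
pose b l := match l with SD => k SD * x | R1D => k R1D * y | R2D => k R2D * y
  | _ => 1 end.
have Nb l : (N l (gain_box x y l) <= (b l)%:E)%E.
  have Nz (z : R) : 0 <= z -> (N l `[(- z)%R, z] <= (k l * z)%:E)%E.
    move=> z0; apply: le_trans (normal_prob_itv_le (s0 l) _) _; first by lra.
    by rewrite lee_fin le_eqVlt; apply/orP; left; apply/eqP; rewrite /k; ring.
  by case: l Nz => /= Nz; rewrite ?N_setT ?Nz.
apply: (@le_trans _ _ (\prod_(l : link) ((b l)%:E * (b l)%:E))%E).
  apply: lee_prod_link => l; first by rewrite mule_ge0// N_ge0.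
  by rewrite lee_pmul// ?N_ge0 ?Nb.
rewrite big_link/= -!EFinM lee_fin le_eqVlt; apply/orP; left; apply/eqP.
by rewrite /b; ring.
Qed.

Lemma prob_decoding_gain_box_ge :
  exists2 m : R, 0 < m & forall x y : R, 0 <= x <= 1 -> 0 <= y <= 1 ->
  ((m * (x ^+ 2 * y ^+ 4))%:E <=
    P (box_event (decoding_gain_box x y) (gain_box x y)))%E.
Proof.
have /choice[m m_spec] : forall l, exists m : R, 0 < m /\ forall u v : R,
    -2 <= u -> u <= v -> v <= 2 -> ((m * (v - u))%:E <= N l `[u, v])%E.
  by move=> l; have [m m0 H] := normal_prob_itv_ge (s0 l); exists m.
have m0 l : 0 < m l by case: (m_spec l).
exists (m SR1 * m SR2 * ((2 * m SD) ^+ 2 * ((2 * m R1D) ^+ 2 * (2 * m R2D) ^+ 2))).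
  by do ?[exact: m0 | apply: exprn_gt0 | apply: mulr_gt0].
move=> x y x01 y01; rewrite /box_event indep; last first.
  move=> l; split; first exact: measurable_decoding_gain_box.
  exact: measurable_gain_box.
pose a l := match l with SD => 2 * m SD * x | R1D => 2 * m R1D * y
  | R2D => 2 * m R2D * y | _ => 1 end.
pose a' l := match l with SR1 => m SR1 | SR2 => m SR2 | _ => a l end.
have Nz l (z : R) : 0 <= z <= 1 -> ((2 * m l * z)%:E <= N l `[(- z)%R, z])%E.
  move=> z01; case: (m_spec l) => _ /(_ (- z) z); rewrite opprK.
  rewrite (_ : 2 * m l * z = m l * (z + z)); last by ring.
  by apply; lra.
have N12 l : ((m l)%:E <= N l `[1%R, 2%R])%E.
  case: (m_spec l) => _ /(_ 1 2); rewrite (_ : m l * (2 - 1) = m l); last by ring.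
  by apply; lra.
have Na l : ((a l)%:E <= N l (gain_box x y l))%E.
  by case: l => /=; rewrite ?N_setT ?Nz.
have Na' l : ((a' l)%:E <= N l (decoding_gain_box x y l))%E.
  by case: l => /=; rewrite ?N12//; exact: Na.
have a0 l : 0 <= a l.
  case/andP: x01 => x0 _; case/andP: y01 => y0 _.
  by case: l => //=; rewrite mulr_ge0// mulr_ge0// ltW.
have a'0 l : 0 <= a' l.
  case: l => /=; rewrite ?(ltW (m0 _))//.
  - exact: (a0 SD).
  - exact: (a0 R1D).
  - exact: (a0 R2D).
apply: (@le_trans _ _ (\prod_(l : link) ((a' l)%:E * (a l)%:E))%E); last first.
  apply: lee_prod_link => l; first by rewrite mule_ge0// lee_fin.
  by rewrite lee_pmul// lee_fin.
rewrite big_link/= -!EFinM lee_fin le_eqVlt; apply/orP; left; apply/eqP.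
by rewrite /a' /a; ring.
Qed.

End gaussian_boxes.

(** * The outage event *)

Section outage_event.
Context {R : realType} {d : measure_display} {T : measurableType d}.

Let measurable_sqn (f g : T -> R) : measurable_fun setT f ->
  measurable_fun setT g -> measurable_fun setT (fun t => sqn (f t) (g t)).
Proof. by move=> mf mg; apply: measurable_funD; exact: measurable_funX. Qed.

Let measurable_ln_sqn (rho : R) (f g : T -> R) : measurable_fun setT f ->
  measurable_fun setT g ->
  measurable_fun setT (fun t => ln (1 + rho * sqn (f t) (g t)) / 2).
Proof.
move=> mf mg; apply: measurable_funM => //; apply: measurableT_comp => //.
by apply: measurable_funD => //; apply: measurable_funM => //; exact: measurable_sqn.
Qed.

Lemma measurable_decodes (SNR Rt : R) (f g : T -> R) : measurable_fun setT f ->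
  measurable_fun setT g -> measurable [set t | decodes SNR Rt (f t) (g t)].
Proof.
move=> mf mg.
have := measurable_ln_sqn (rho0 SNR) mf mg.
move=> /(_ measurableT `[Rt, +oo[%classic (measurable_itv _)); rewrite setTI.
by congr (measurable _); apply/seteqP; split=> t; rewrite /= /decodes in_itv/= andbT.
Qed.

(** Multiplying by the indicator of [D] gives a nonnegative jointly measurable function of outcome
    and frequency, whose partial integral is measurable by Tonelli. *)
Lemma measurable_integral_ln_trigpol (rho w : R) (D : set R) (A p q : T -> R) :
  measurable D -> 0 <= rho -> (forall t, 0 <= A t) ->
  (forall t, 4 * (p t ^+ 2 + q t ^+ 2) <= A t ^+ 2) ->
  measurable_fun setT A -> measurable_fun setT p -> measurable_fun setT q ->
  measurable_fun setT (fun t => \int[lebesgue_measure]_(f in D)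
    (ln (1 + rho * trigpol (A t) (p t) (q t) (w * f)))%:E)%E.
Proof.
move=> mD rho0 A0 pqA mA mp mq.
pose F (z : T * R) : \bar R :=
  (ln (1 + rho * trigpol (A z.1) (p z.1) (q z.1) (w * z.2)) * \1_D z.2)%:E.
have mF : measurable_fun setT F.
  apply/measurable_EFinP; apply: measurable_funM; last first.
    by apply: measurableT_comp => //; exact: measurable_indic.
  have m1 (f : T -> R) : measurable_fun setT f ->
      measurable_fun setT (fun z : T * R => f z.1).
    by move=> mf; exact: measurableT_comp.
  have mw : measurable_fun setT (fun z : T * R => w * z.2).
    by apply: measurable_funM.
  apply: measurableT_comp => //; apply: measurable_funD => //.
  apply: measurable_funM => //; apply: measurable_funD; first exact: m1.
  apply: measurable_funM => //; apply: measurable_funD.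
    apply: measurable_funM; first exact: m1.
    apply: measurableT_comp mw.
    exact: (continuous_measurable_fun (@continuous_cos R)).
  apply: measurable_funM; first exact: m1.
  apply: measurableT_comp mw.
  exact: (continuous_measurable_fun (@continuous_sin R)).
have F0 z : (0 <= F z)%E by rewrite lee_fin mulr_ge0// ln_trigpol_ge0.
rewrite (_ : (fun t => _) = fubini_F lebesgue_measure F).
  exact: measurable_fun_fubini_tonelli_F.
apply/funext => t; rewrite /fubini_F [LHS]integral_mkcond; apply: eq_integral => f _.
rewrite /F/= patchE indicE; case: (f \in D); first by rewrite mulr1.
by rewrite mulr0.
Qed.

Lemma measurable_outage (P : probability T R) (Xre Xim : link -> {RV P >-> R})
    (Bw tau1 tau2 SNR Rt : R) : 0 <= SNR ->
  measurable [set t | let dec1 := decodes SNR Rt (Xre SR1 t) (Xim SR1 t) in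
             let dec2 := decodes SNR Rt (Xre SR2 t) (Xim SR2 t) in
             [/\ dec1, dec2 &
               (I_TDA Bw tau1 tau2 SNR dec1 dec2 (Xre SD t) (Xim SD t)
                  (Xre R1D t) (Xim R1D t) (Xre R2D t) (Xim R2D t)
                < Rt%:E)%E]].
Proof.
move=> SNR0.
pose I t := I_TDA Bw tau1 tau2 SNR true true (Xre SD t) (Xim SD t)
                  (Xre R1D t) (Xim R1D t) (Xre R2D t) (Xim R2D t).
(* Where both relays decode, the two flags in [I_TDA] are true, so the event is an intersection with
   a sublevel set of one fixed function. *)
rewrite (_ : [set t | _] = [set t | decodes SNR Rt (Xre SR1 t) (Xim SR1 t)] `&`
    ([set t | decodes SNR Rt (Xre SR2 t) (Xim SR2 t)] `&`
     (setT `&` [set t | (I t < Rt%:E)%E]))); last first.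
  apply/seteqP; split=> t /=.
    by move=> [d1 d2]; rewrite d1 d2.
  by move=> [d1 [d2 [_ It]]]; rewrite d1 d2.
apply: measurableI; first exact: measurable_decodes.
apply: measurableI; first exact: measurable_decodes.
apply: measurable_lte => //; rewrite /I.
under eq_fun do rewrite I_TDA_trigpol.
apply: emeasurable_funD.
  by apply/measurable_EFinP; exact: measurable_ln_sqn.
apply: emeasurable_funM => //; apply: measurable_integral_ln_trigpol => //.
- by rewrite /rho0 mulr_ge0// divr_ge0.
- by move=> t; rewrite addr_ge0 ?sqn_ge0.
- by move=> t; exact: sqn_cross_le.
- by apply: measurable_funD; exact: measurable_sqn.
- by apply: measurable_funD; exact: measurable_funM.
- by apply: measurable_funB; exact: measurable_funM.
Qed.

End outage_event.

(** * Elementary estimates for covering by boxes *)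

Lemma dyadic_bracket (R : realType) (z : R) : 1 <= z ->
  exists k : nat, 2 ^+ k <= z < 2 ^+ k.+1.
Proof.
move=> z1.
have ex : exists n : nat, z < 2 ^+ n.
  exists (Num.truncn z).+1; apply: lt_trans (truncnS_gt z) _.
  by rewrite -natrX ltr_nat ltn_expl.
case: (ex_minnP ex) => -[|k]; first by rewrite expr0 ltNge z1.
move=> zk mink; exists k; rewrite zk andbT leNgt; apply/negP => /mink.
by rewrite ltnn.
Qed.

Lemma powR_outage_exponent (R : realType) (S r : R) : 0 < S ->
  S `^ (- (3 - 4 * r)) = (S `^ (2 * r)) ^+ 2 / S ^+ 3.
Proof.
move=> S0; rewrite /powR gt_eqF//.
rewrite -expRM_natl -{3}(lnK S0) -expRM_natl -expRN -expRD.
by congr expR; ring.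
Qed.

(** From [1 + S <= 2 S], with [2 r < 1] absorbing the coefficient of [ln 2]; thus twice the target
    rate is at most [ln (2 S^(2r))]. *)
Lemma ln1D_le (R : realType) (S r : R) : 1 <= S -> 0 < r < 1 / 2 ->
  2 * (r * ln (1 + S)) <= ln 2 + 2 * r * ln S.
Proof.
move=> S1 r01.
have l2 : 0 <= ln (2 : R) by apply: ln_ge0; lra.
have : ln (1 + S) <= ln 2 + ln S.
  by rewrite -lnM ?posrE//; [rewrite ler_ln ?posrE|]; lra.
by nra.
Qed.

(** Discs are exchanged for squares, to which the product rule applies; the converse passage costs a
    factor 2. *)
Lemma sqn_le_box (R : realType) (a b z : R) : 0 <= z -> sqn a b <= z ->
  - Num.sqrt z <= a <= Num.sqrt z /\ - Num.sqrt z <= b <= Num.sqrt z.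
Proof.
rewrite /sqn => z0 abz; have a0 := sqr_ge0 a; have b0 := sqr_ge0 b.
have key (c : R) : c ^+ 2 <= z -> - Num.sqrt z <= c <= Num.sqrt z.
  by move=> cz; rewrite -ler_norml -sqrtr_sqr ler_wsqrtr.
by split; apply: key; lra.
Qed.

Lemma sqn_box_le (R : realType) (a b z : R) : 0 <= z ->
  - Num.sqrt z <= a <= Num.sqrt z -> - Num.sqrt z <= b <= Num.sqrt z ->
  sqn a b <= 2 * z.
Proof.
move=> z0.
have key (c : R) : - Num.sqrt z <= c <= Num.sqrt z -> c ^+ 2 <= z.
  rewrite -ler_norml => cz; rewrite -(sqr_sqrtr z0) -[c ^+ 2]real_normK ?num_real//.
  by rewrite ler_pXn2r ?nnegrE ?sqrtr_ge0.
by move=> /key az /key bz; rewrite /sqn; lra.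
Qed.

(** * Matching upper and lower bounds on the outage probability *)

Section outage_probability.
Context {R : realType} {d : measure_display} {T : measurableType d}.
Variables (P : probability T R) (Xre Xim : link -> {RV P >-> R}).
Variables (sigma2 : link -> R) (Bw tau1 tau2 r : R).
Hypothesis sigma2_gt0 : forall l, 0 < sigma2 l.
Hypothesis indep :
  indep_CSCG P (fun l => Xre l : T -> R) (fun l => Xim l : T -> R) sigma2.
Hypotheses (Bw0 : 0 < Bw) (r01 : 0 < r < 1 / 2).

Let Pout SNR := P_out P (fun l => Xre l : T -> R) (fun l => Xim l : T -> R)
                  sigma2 Bw tau1 tau2 r SNR.
Let st SNR := snrt (sigma2 SD) SNR.
Let kappa : R := 2 / 3 / sigma2 SD.

Let kappa_gt0 : 0 < kappa.
Proof. by rewrite divr_gt0// divr_gt0. Qed.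

Let rho_st SNR : rho0 SNR = kappa * st SNR.
Proof. by rewrite /rho0 /kappa /st /snrt; field; rewrite gt_eqF. Qed.

Let rate_st SNR : rate (sigma2 SD) r SNR = r * ln (1 + st SNR).
Proof. by rewrite /rate /st /snrt mulrC [_ * SNR]mulrC mulrC. Qed.

Lemma outage_probability_le : tau1 != tau2 ->
  exists2 c2 : R, 0 < c2 & forall SNR : R, 0 < SNR -> 1 <= st SNR ->
    (Pout SNR <= (c2 * st SNR `^ (- (3 - 4 * r)))%:E)%E.
Proof.
move=> tau12.
have w0 : 2 * pi * (tau1 - tau2) != 0 :> R.
  by rewrite mulf_neq0 ?subr_eq0// gt_eqF// mulr_gt0 ?pi_gt0.
have [C intge] := integral_ln_trigpol_ge Bw0 w0.
have [M M0 boxle] := prob_gain_box_le sigma2_gt0 indep.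
exists (16 * M * expR C ^+ 2 / kappa ^+ 3).
  by rewrite divr_gt0 ?exprn_gt0// mulr_gt0 ?exprn_gt0 ?expR_gt0// mulr_gt0.
move=> SNR SNR0; set S := st SNR => S1.
have S0 : 0 < S by lra.
set rho := rho0 SNR; have rhoS : rho = kappa * S by exact: rho_st.
have rho_gt0 : 0 < rho by rewrite rhoS mulr_gt0.
(* In outage [(1 + rho sd)(1 + rho A) <= K]: the factor [expR C] pays for the integral loss and 2
   for replacing [1 + S] by [S]. *)
pose K := expR C * 2 * S `^ (2 * r).
have K0 : 0 < K by rewrite /K mulr_gt0 ?powR_gt0// mulr_gt0 ?expR_gt0.
(* Box [k] serves the outcomes with [2^k <= 1 + rho sd < 2^(k+1)]; the product bound then forces
   [rho A <= K / 2^k]. *)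
pose x2 k := 2 ^+ k.+1 / rho; pose y2 k := K / 2 ^+ k / rho.
have x20 k : 0 <= x2 k by rewrite /x2 divr_ge0 ?exprn_ge0// ltW.
have y20 k : 0 <= y2 k by rewrite /y2 !divr_ge0 ?exprn_ge0// ltW.
pose B k := box_event Xre Xim (gain_box (Num.sqrt (x2 k)) (Num.sqrt (y2 k)))
                     (gain_box (Num.sqrt (x2 k)) (Num.sqrt (y2 k))).
have mB k : measurable (B k).
  by apply: measurable_box_event => l; split; exact: measurable_gain_box.
rewrite /Pout /P_out; set E := [set t | _].
have mE : measurable E by apply: measurable_outage; exact: ltW.
(* Box [k] has probability at most [M x2 y2^2 = eps / 2^(k+1)], so the union bound sums to [eps]. *)
pose eps := 4 * M * K ^+ 2 / rho ^+ 3.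
have eps0 : 0 <= eps.
  rewrite /eps divr_ge0 ?exprn_ge0 ?(ltW rho_gt0)//.
  by rewrite mulr_ge0 ?sqr_ge0// mulr_ge0// ltW.
have -> : 16 * M * expR C ^+ 2 / kappa ^+ 3 * S `^ (- (3 - 4 * r)) = eps.
  rewrite powR_outage_exponent// /eps rhoS /K.
  by field; rewrite !gt_eqF.
apply: (@le_trans _ _ (\sum_(0 <= k <oo) P (B k))%E).
  apply: measure_sigma_subadditive => // t; rewrite /E/= => -[d1 d2].
  rewrite d1 d2.
  set sd := sqn (Xre SD t) (Xim SD t).
  set A := sqn (Xre R1D t) (Xim R1D t) + sqn (Xre R2D t) (Xim R2D t).
  have sd0 : 0 <= sd by exact: sqn_ge0.
  have A0 : 0 <= A by rewrite addr_ge0 ?sqn_ge0.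
  move=> /(le_lt_trans (I_TDA_ge _ _ _ _ _ _ Bw0 (ltW SNR0) intge)).
  rewrite lte_fin -/rho -/sd -/A rate_st -/S => outage.
  have rsd0 : 0 <= rho * sd by rewrite mulr_ge0// ltW.
  have rA0 : 0 <= rho * A by rewrite mulr_ge0// ltW.
  have prodK : (1 + rho * sd) * (1 + rho * A) <= K.
    rewrite -(@ler_ln R) ?posrE//; last by rewrite mulr_gt0//; lra.
    have -> : ln K = C + ln 2 + 2 * r * ln S.
      rewrite /K lnM ?posrE ?powR_gt0//; last by rewrite mulr_gt0 ?expR_gt0.
      by rewrite lnM ?posrE ?expR_gt0// expRK ln_powR.
    rewrite lnM ?posrE; [|lra|lra].
    by have := ln1D_le S1 r01; lra.
  have [k /andP[kz zk]] : exists k : nat, 2 ^+ k <= 1 + rho * sd < 2 ^+ k.+1.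
    by apply: dyadic_bracket; lra.
  have k20 : 0 < 2 ^+ k :> R by rewrite exprn_gt0.
  exists k => //.
  have sdx : sd <= x2 k by rewrite /x2 ler_pdivlMr// mulrC; lra.
  have Ay : A <= y2 k.
    rewrite /y2 ler_pdivlMr// mulrC ler_pdivlMr//; apply: le_trans prodK.
    by rewrite [leLHS]mulrC ler_pM ?lerDr// ltW.
  have [a1 a2] := sqn_le_box (x20 k) sdx.
  have [|b1 b2] := @sqn_le_box R (Xre R1D t) (Xim R1D t) _ (y20 k).
    by apply: le_trans Ay; rewrite lerDl sqn_ge0.
  have [|b3 b4] := @sqn_le_box R (Xre R2D t) (Xim R2D t) _ (y20 k).
    by apply: le_trans Ay; rewrite lerDr sqn_ge0.
  by case=> /=; rewrite ?in_itv/=.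
apply: (@le_trans _ _ (\sum_(k <oo) (eps / (2 ^ k.+1)%:R)%:E)%E); last first.
  exact: epsilon_trick0.
apply: lee_nneseries => // k _.
apply: le_trans (boxle _ _ (sqrtr_ge0 _) (sqrtr_ge0 _)) _.
rewrite lee_fin le_eqVlt; apply/orP; left; apply/eqP.
rewrite (_ : 4%N = (2 * 2)%N)// exprM !sqr_sqrtr// /x2 /y2 /eps natrX !exprS.
by field; rewrite !gt_eqF// exprn_gt0.
Qed.

Lemma outage_probability_ge :
  exists c1 S1 : R, 0 < c1 /\ forall SNR : R, 0 < SNR -> S1 <= st SNR ->
    ((c1 * st SNR `^ (- (3 - 4 * r)))%:E <= Pout SNR)%E.
Proof.
have [m m0 boxge] := prob_decoding_gain_box_ge sigma2_gt0 indep.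
(* The bound 1 keeps the boxes inside the unit range; [kappa eta <= 1/32] makes [rho sd <= 1/4] and
   [2 rho A <= t / 4] on the box. *)
pose eta := Num.min 1 (32 * kappa)^-1.
have eta0 : 0 < eta by rewrite lt_min ltr01 invr_gt0 mulr_gt0.
have eta1 : eta <= 1 by rewrite ge_min lexx.
have etak : kappa * eta <= 1 / 32.
  have : eta <= (32 * kappa)^-1 by rewrite ge_min lexx orbT.
  rewrite -(ler_pM2l kappa_gt0) => /le_trans; apply.
  by rewrite le_eqVlt; apply/orP; left; apply/eqP; field; rewrite gt_eqF.
have [r_gt0 r_lt] := andP r01.
have r12 : 0 < 1 - 2 * r by lra.
(* The second threshold means [kappa S >= 2 S^(2r)], so a relay with source power gain at least 1
   decodes; the third means [S^(2r) >= 2]. *)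
exists (m * eta ^+ 3), (Num.max 1 (Num.max (expR ((ln 2 - ln kappa) / (1 - 2 * r)))
                                      (expR (ln 2 / (2 * r))))).
split; first by rewrite mulr_gt0// exprn_gt0.
move=> SNR SNR0; set S := st SNR; rewrite !ge_max => /and3P[S1 Sdec St].
have S0 : 0 < S by lra.
have r0 : 0 < 2 * r by lra.
have decS : ln 2 - ln kappa <= (1 - 2 * r) * ln S.
  by rewrite mulrC -ler_pdivrMr// -ler_expR lnK.
have tS : ln 2 <= 2 * r * ln S.
  by rewrite mulrC -ler_pdivrMr// -ler_expR lnK.
set rho := rho0 SNR; have rhoS : rho = kappa * S by exact: rho_st.
have rho_gt0 : 0 < rho by rewrite rhoS mulr_gt0.
pose t := S `^ (2 * r).
have lnt : ln t = 2 * r * ln S by rewrite /t ln_powR.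
have t0 : 0 < t by exact: powR_gt0.
have t2 : 2 <= t by rewrite -ler_ln ?posrE// lnt.
have tS1 : t <= S.
  by rewrite -ler_ln ?posrE// lnt; have := ln_ge0 S1; nra.
pose x2 := eta / S; pose y2 := eta * t / S.
have x20 : 0 <= x2 by rewrite divr_ge0// ltW.
have y20 : 0 <= y2 by rewrite divr_ge0 ?mulr_ge0// ltW.
have x21 : x2 <= 1 by rewrite ler_pdivrMr//; lra.
have y21 : y2 <= 1.
  rewrite ler_pdivrMr// mul1r; apply: le_trans tS1.
  by rewrite ger_pMl.
have sqrt01 (z : R) : 0 <= z -> z <= 1 -> 0 <= Num.sqrt z <= 1.
  by move=> z0 z1; rewrite sqrtr_ge0 -sqrtr1 ler_wsqrtr.
rewrite /Pout /P_out; set E := [set t | _].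
have mE : measurable E by apply: measurable_outage; exact: ltW.
have -> : m * eta ^+ 3 * S `^ (- (3 - 4 * r)) =
    m * (Num.sqrt x2 ^+ 2 * Num.sqrt y2 ^+ 4).
  rewrite (_ : 4%N = (2 * 2)%N)// exprM !sqr_sqrtr// powR_outage_exponent//.
  by rewrite -/t /x2 /y2; field; rewrite gt_eqF.
apply: le_trans (boxge _ _ (sqrt01 _ x20 x21) (sqrt01 _ y20 y21)) _.
apply: le_measure; rewrite ?inE//.
  apply: measurable_box_event => l; split; first exact: measurable_decoding_gain_box.
  exact: measurable_gain_box.
move=> o Ho.
have [sr1 _] := Ho SR1; have [sr2 _] := Ho SR2; have [sd1 sd2] := Ho SD.
have [g11 g12] := Ho R1D; have [g21 g22] := Ho R2D; clear Ho.
move: sr1 sr2 sd1 sd2 g11 g12 g21 g22; rewrite /= !in_itv/=.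
move=> sr1 sr2 sd1 sd2 g11 g12 g21 g22.
rewrite /E/= rate_st -/S.
have dec a b : 1 <= a <= 2 -> decodes SNR (r * ln (1 + S)) a b.
  move=> a12; rewrite /decodes ler_pdivlMr// mulrC -/rho.
  have sq1 : 1 <= sqn a b by rewrite /sqn; have := sqr_ge0 b; nra.
  have : ln (kappa * S) <= ln (1 + rho * sqn a b).
    rewrite ler_ln ?posrE -?rhoS//; last by rewrite ltr_pwDl// mulr_ge0 ?sqn_ge0// ltW.
    by nra.
  rewrite lnM ?posrE//; apply: le_trans.
  by have := ln1D_le S1 r01; lra.
rewrite !dec//; split=> //.
apply: le_lt_trans (I_TDA_le _ _ _ _ _ _ _ _ Bw0 (ltW SNR0)) _.
rewrite lte_fin -/rho.
have sdle := sqn_box_le x20 sd1 sd2.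
have g1le := sqn_box_le y20 g11 g12; have g2le := sqn_box_le y20 g21 g22.
set sd := sqn _ _ in sdle *; set A := sqn _ _ + _.
have sd0 : 0 <= sd by exact: sqn_ge0.
have A0 : 0 <= A by rewrite addr_ge0 ?sqn_ge0.
have rsd0 : 0 <= rho * sd by rewrite mulr_ge0// ltW.
have rA0 : 0 <= rho * (2 * A) by rewrite !mulr_ge0// ltW.
have rsd : rho * sd <= 1 / 4.
  have : rho * sd <= rho * (2 * x2) by rewrite ler_pM2l.
  have -> : rho * (2 * x2) = 2 * (kappa * eta).
    by rewrite rhoS /x2; field; rewrite gt_eqF.
  by lra.
have rA : rho * (2 * A) <= t / 4.
  have : rho * (2 * A) <= rho * (8 * y2) by rewrite ler_pM2l// /A; lra.
  have -> : rho * (8 * y2) = 8 * (kappa * eta) * t.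
    by rewrite rhoS /y2; field; rewrite gt_eqF.
  by nra.
rewrite -lnM ?posrE; [|lra|lra].
(* The product is at most [(5/4)(1 + t/4)], which is strictly below [t] because [t >= 2]. *)
have : ln ((1 + rho * sd) * (1 + rho * (2 * A))) < ln t.
  by rewrite ltr_ln ?posrE//; [nra|rewrite mulr_gt0//; lra].
have : ln S <= ln (1 + S) by rewrite ler_ln ?posrE//; lra.
by rewrite lnt; nra.
Qed.

End outage_probability.

Theorem theorem2 (R : realType) (d : measure_display) (T : measurableType d)
    (P : probability T R) (Xre Xim : link -> {RV P >-> R})
    (sigma2 : link -> R) (Bw tau1 tau2 r : R) :
  (forall l, 0 < sigma2 l) ->
  indep_CSCG P (fun l => Xre l : T -> R) (fun l => Xim l : T -> R) sigma2 ->
  0 < Bw -> 0 <= tau1 -> 0 <= tau2 -> 0 < r < 1 / 2 ->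
  let T0 := `|tau2 - tau1| in
  let Pout SNR := P_out P (fun l => Xre l : T -> R) (fun l => Xim l : T -> R)
                    sigma2 Bw tau1 tau2 r SNR in
  let st SNR := snrt (sigma2 SD) SNR in
  (* (a) *)
  ((2 < T0 * Bw -> ~ (exists n : int, T0 * Bw = n%:~R) ->
    exists c1 c2 SNR0 : R, [/\ 0 < c1, 0 < c2 &
      forall SNR : R, 0 < SNR -> SNR0 <= SNR ->
        ((c1 * st SNR `^ (- (3 - 4 * r)))%:E <= Pout SNR)%E /\
        (Pout SNR <= (c2 * st SNR `^ (- (3 - 6 * r)))%:E)%E])
  /\
  (* (b) *)
  ((exists n : nat, (0 < n)%N /\ T0 * Bw = n%:R) ->
    exists c1 c2 SNR0 : R, [/\ 0 < c1, 0 < c2 &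
      forall SNR : R, 0 < SNR -> SNR0 <= SNR ->
        ((c1 * st SNR `^ (- (3 - 4 * r)))%:E <= Pout SNR)%E /\
        (Pout SNR <= (c2 * st SNR `^ (- (3 - 4 * r)))%:E)%E])).
Proof.
move=> sigma2_gt0 indep Bw0 _ _ r01 T0 Pout st.
have T0_neq : 0 < T0 * Bw -> tau1 != tau2.
  apply: contraTneq => tau12.
  by rewrite /T0 tau12 subrr normr0 mul0r ltxx.
have sharp : tau1 != tau2 -> exists c1 c2 SNR0 : R, [/\ 0 < c1, 0 < c2 &
    forall SNR : R, 0 < SNR -> SNR0 <= SNR -> [/\ 1 <= st SNR,
      ((c1 * st SNR `^ (- (3 - 4 * r)))%:E <= Pout SNR)%E &
      (Pout SNR <= (c2 * st SNR `^ (- (3 - 4 * r)))%:E)%E]].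
  move=> tau12.
  have [c2 c20 upper] := outage_probability_le sigma2_gt0 indep Bw0 r01 tau12.
  have [c1 [S1 [c10 lower]]] :=
    outage_probability_ge tau1 tau2 sigma2_gt0 indep Bw0 r01.
  (* The threshold on the normalised SNR is converted to one on [SNR]; the value 1 in the maximum
     also makes powers of [st SNR] monotone in the exponent. *)
  exists c1, c2, (Num.max 1 S1 / sigma2 SD); split=> // SNR SNR0.
  rewrite ler_pdivrMr// mulrC ge_max => /andP[st1 stS1].
  by split; [exact: st1|exact: lower|exact: upper].
split=> [T0Bw _|[n [n0 T0Bw]]].
- have [|c1 [c2 [SNR0 [c10 c20 bounds]]]] := sharp; first by apply: T0_neq; lra.
  exists c1, c2, SNR0; split=> // SNR SNR_gt0 SNR_ge.
  have [st1 lower upper] := bounds _ SNR_gt0 SNR_ge; split=> //.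
  (* The base is at least 1 and [r > 0], so the exponent [-(3 - 4r)] may be raised to
     [-(3 - 6r)]. *)
  apply: le_trans upper _; rewrite lee_fin ler_pM2l// ler_powR//.
  by have /andP[r0 _] := r01; lra.
- have [|c1 [c2 [SNR0 [c10 c20 bounds]]]] := sharp.
    by apply: T0_neq; rewrite T0Bw ltr0n.
  exists c1, c2, SNR0; split=> // SNR SNR_gt0 SNR_ge.
  by have [_ lower upper] := bounds _ SNR_gt0 SNR_ge.
Qed.
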